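(* There exist absolute constants $C>0$ and $c>0$ such that the following holds. Let $\epsilon \in (0,1)$, let $n$ be an even positive integer, and let $\mathcal{A} \subset {[n] \choose n/2}$ with $\mathcal{A} \neq \emptyset$ and $\mathcal{A} \neq {[n] \choose n/2}$. Suppose further that $$n \geq \frac{C}{\epsilon^2}\left(\log(1/\epsilon)+\log\left(\frac{1}{\mu(\mathcal{A})(1-\mu(\mathcal{A}))}\right)\right).$$ Then, for $r = \lceil \epsilon \sqrt{n} \rceil$, we have $$\mu\left(\partial^{+r}(\mathcal{A})\cap\partial^{+r}(\mathcal{A}^c)\right) \geq c\,\frac{\epsilon^2}{\log \left(\frac{1}{\epsilon\, \mu(\mathcal{A})(1-\mu(\mathcal{A}))}\right)}\,\mu(\mathcal{A})(1-\mu(\mathcal{A})).$$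
   Context: $[n]=\{1,\dots,n\}$ and ${[n] \choose k}$ denotes the set of $k$-element subsets of $[n]$. For $\mathcal{F} \subset {[n] \choose k}$, $\mu(\mathcal{F}) = |\mathcal{F}|/{n \choose k}$ is the uniform measure on the layer ${[n] \choose k}$. $\mathcal{A}^c = {[n] \choose n/2}\setminus \mathcal{A}$. For $\mathcal{A} \subset {[n] \choose k}$ and $r \leq n-k$, the $r$-th iterated upper shadow is $\partial^{+r}(\mathcal{A}) = \{B \in {[n] \choose k+r}: B \supset A \text{ for some } A \in \mathcal{A}\}$; so here $\partial^{+r}(\mathcal{A})\cap\partial^{+r}(\mathcal{A}^c) \subset {[n] \choose n/2+r}$ and $\mu$ of it is taken in that layer. *)

(* Defs.v *)
From Stdlib Require Import Reals ZArith.
From mathcomp Require Import all_boot.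
Set Implicit Arguments. Unset Strict Implicit. Unset Printing Implicit Defensive.

Definition layer (n k : nat) : {set {set 'I_n}} := [set A : {set 'I_n} | #|A| == k].

Definition mu (n k : nat) (F : {set {set 'I_n}}) : R :=
  Rdiv (INR #|F|) (INR 'C(n, k)).

Definition upper_shadow (n k r : nat) (F : {set {set 'I_n}}) : {set {set 'I_n}} :=
  [set B : {set 'I_n} | (#|B| == k + r) && [exists A in F, A \subset B]].

Definition compl_mid (n : nat) (F : {set {set 'I_n}}) : {set {set 'I_n}} :=
  layer n n./2 :\: F.

(* ceiling of a real number, as an integer: up y is the unique integer with y < up y <= y+1,
   so floor y = up y - 1 and ceil x = - floor (-x) = 1 - up (-x). *)
Definition Zceil (x : R) : Z := (1 - up (- x))%Z.
Definition nat_ceil (x : R) : nat := Z.to_nat (Zceil x).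

(* Main.v *)
(* Idea.  In the layer K = n/2 + r let P1 be the sets all of whose n/2-subsets
   lie in A, P0 those all of whose n/2-subsets avoid A, and M the rest, i.e. the
   intersection of the two shadows.  If x is in P1 and y in P0 then x :&: y has
   no n/2-subset, so their Johnson distance exceeds r.  Hence the distance to
   P1, truncated at r, is a 1-Lipschitz function that only varies along edges
   meeting M; the Poincare inequality for the Johnson graph (spectral gap n)
   bounds its variance by O(n mu(M)), while the variance is at least
   r^2 mu(P1) mu(P0).  As r^2 >= eps^2 n this gives
   mu(M) >= 4 eps^2 mu(P1) mu(P0), and by the local LYM inequality
   mu(P1) >= mu(A) - mu(M) and mu(P0) >= 1 - mu(A) - mu(M).  The logarithm in the
   statement is at least 1, so it may be dropped. *)
Require Import Defs.
From Stdlib Require Import Reals ZArith Lra.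
From mathcomp Require Import all_boot all_order all_algebra zify.
From mathcomp Require ring lra.

(** * Spectral gap of the Johnson graph by up and down operators *)

Section JohnsonPoincare.
Import Order.TTheory GRing.Theory Num.Theory.
Import mathcomp.algebra_tactics.ring mathcomp.algebra_tactics.lra.
Local Open Scope ring_scope.
Variables (F : realFieldType) (n : nat).
Implicit Types (f g : {set 'I_n} -> F) (S B : {set 'I_n}).

Definition down_op f S := \sum_(a | a \notin S) f (a |: S).
Definition up_op g B := \sum_(b in B) g (B :\ b).

(** Both sides run over covering pairs of adjacent layers, matched by [B = a |: S]; every later
    change of layer rests on this double count. *)
Lemma sum_flags k (h : {set 'I_n} -> 'I_n -> F) :
  \sum_(B : {set 'I_n} | #|B| == k.+1) \sum_(b in B) h B b =
  \sum_(S : {set 'I_n} | #|S| == k) \sum_(a | a \notin S) h (a |: S) a.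
Proof.
rewrite (exchange_big_dep xpredT) //= [RHS](exchange_big_dep xpredT) //=.
apply: eq_bigr => b _.
rewrite (reindex_onto (fun S => b |: S) (fun B => B :\ b)) /=; last first.
  by move=> B /andP[_ bB]; rewrite setD1K.
apply: eq_bigl => S.
rewrite setU11 andbT; have [bS|bS] := boolP (b \in S).
  rewrite andbF; apply/negP => /andP[_ /eqP E].
  by move: bS; rewrite -E setD11.
by rewrite cardsU1 bS add1n eqSS setU1K // eqxx andbT.
Qed.

Lemma sum_notin_const S (c : F) : \sum_(a | a \notin S) c = (n - #|S|)%:R * c.
Proof.
have := congr1 (subn^~ #|S|) (cardC (mem S)); rewrite addKn card_ord => <-.
by rewrite sumr_const mulr_natl.
Qed.

Lemma sum_down k f :
  \sum_(S : {set 'I_n} | #|S| == k) down_op f S =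
  k.+1%:R * \sum_(B : {set 'I_n} | #|B| == k.+1) f B.
Proof.
rewrite -(sum_flags k (fun B _ => f B)) mulr_sumr.
by apply: eq_bigr => B /eqP cB; rewrite sumr_const cB mulr_natl.
Qed.

Lemma up_down_adjoint k f g :
  \sum_(B : {set 'I_n} | #|B| == k.+1) f B * up_op g B =
  \sum_(S : {set 'I_n} | #|S| == k) down_op f S * g S.
Proof.
under eq_bigr do rewrite mulr_sumr.
rewrite (sum_flags k (fun B b => f B * g (B :\ b))).
apply: eq_bigr => S _; rewrite mulr_suml.
by apply: eq_bigr => a aS; rewrite setU1K.
Qed.

(** Both compositions exchange one element for another. Proper exchanges give the same sum [X] in
    either order; only the trivial ones differ, with [n - k] against [k] copies of [g S]. *)
Lemma down_up_commute k g S : #|S| = k -> (k <= n)%N ->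
  down_op (up_op g) S = up_op (down_op g) S + (n%:R - k%:R *+ 2) * g S.
Proof.
move=> cS kn.
pose Y a : F := \sum_(b in S) g (a |: (S :\ b)).
pose X : F := \sum_(a | a \notin S) Y a.
have -> : down_op (up_op g) S = (n%:R - k%:R) * g S + X.
  rewrite /down_op /up_op -natrB // -cS -sum_notin_const.
  rewrite -big_split /=; apply: eq_bigr => a aS.
  rewrite (big_setU1 a) //= setU1K //; congr (_ + _).
  rewrite /Y; apply: eq_bigr => b bS; congr (g _); apply/setP => z; rewrite !inE.
  by have [->|] := eqVneq z a => //=; rewrite andbT; apply: contraNneq aS => ->.
have -> : up_op (down_op g) S = k%:R * g S + X.
  rewrite /X /Y /down_op /up_op -cS mulr_natl -sumr_const [X in _ = _ + X](exchange_big_dep (mem S)) //=.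
  rewrite -(@big_split F) /=; apply: eq_bigr => b bS.
  rewrite (bigD1 b) /= ?setD11 // setD1K //; congr (_ + _).
  apply: eq_bigl => a; rewrite !inE.
  by have [->|] := eqVneq a b; rewrite ?bS //= andbT.
by rewrite mulr2n; ring.
Qed.

(* The constant is the second eigenvalue of up_op \o down_op on a layer.  By
   duality |down_op f|^2 = <f, up_op (down_op f)>, and the commutation rule reduces
   |up_op (down_op f)|^2 to the same bound one layer below. *)
Lemma down_norm_le k f : (k.+1 < n)%N ->
  \sum_(B : {set 'I_n} | #|B| == k.+1) f B = 0 ->
  \sum_(S : {set 'I_n} | #|S| == k) down_op f S ^+ 2 <=
  (k * (n - k.+1))%:R * \sum_(B : {set 'I_n} | #|B| == k.+1) f B ^+ 2.
Proof.
elim: k f => [|k IH] f kn sum_f.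
  (* On layer 0 the only [S] is the empty set, where [down_op f] is the full sum of [f], hence
     zero. *)
  rewrite mul0n mul0r big1 // => S cS.
  have E : \sum_(T : {set 'I_n} | #|T| == 0%N) down_op f T = 0.
    by rewrite sum_down sum_f mulr0.
  move: E; rewrite (bigD1 S) //= big1 ?addr0 => [->|T].
    by rewrite expr0n.
  move: cS; rewrite !cards_eq0 => /eqP-> /andP[/eqP->].
  by rewrite eqxx.
set g := down_op f.
have sum_g : \sum_(S : {set 'I_n} | #|S| == k.+1) g S = 0.
  by rewrite sum_down sum_f mulr0.
have {IH} IHg := IH g (ltnW kn) sum_g.
set L : F := (k.+1 * (n - k.+2))%:R.
have L_gt0 : 0 < L by rewrite ltr0n muln_gt0 subn_gt0.
set G := \sum_(S : {set 'I_n} | #|S| == k.+1) g S ^+ 2 in IHg *.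
set N := \sum_(B : {set 'I_n} | #|B| == k.+2) f B ^+ 2.
have up_g : \sum_(B : {set 'I_n} | #|B| == k.+2) up_op g B ^+ 2 <= L * G.
  have -> : \sum_(B : {set 'I_n} | #|B| == k.+2) up_op g B ^+ 2 =
     \sum_(S : {set 'I_n} | #|S| == k) down_op g S ^+ 2
     + (n%:R - k.+1%:R *+ 2) * G.
    under eq_bigr do rewrite expr2.
    rewrite up_down_adjoint mulr_sumr.
    transitivity (\sum_(S : {set 'I_n} | #|S| == k.+1)
        (g S * up_op (down_op g) S + (n%:R - k.+1%:R *+ 2) * g S ^+ 2)).
      apply: eq_bigr => S /eqP cS.
      by rewrite (down_up_commute k.+1 _ _ cS (ltnW (ltnW kn))); ring.
    by rewrite big_split /= up_down_adjoint; congr (_ + _); apply: eq_bigr.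
  (* Eigenvalue recursion: (k+1)(n-k-2) = k(n-k-1) + n - 2(k+1). *)
  have -> : L = (k * (n - k.+1))%:R + (n%:R - k.+1%:R *+ 2).
    rewrite /L !natrM (natrB _ (ltnW kn)) (natrB _ (ltnW (ltnW kn))).
    by rewrite -!natr1; ring.
  by rewrite [leRHS]mulrDl lerD2r.
have fg : \sum_(B : {set 'I_n} | #|B| == k.+2) f B * up_op g B = G.
  by rewrite up_down_adjoint; apply: eq_bigr => S _; rewrite expr2.
(* Expanding this square with [up_g] gives L(LN - G) >= 0, and L > 0 can be cancelled. *)
have : 0 <= \sum_(B : {set 'I_n} | #|B| == k.+2) (L * f B - up_op g B) ^+ 2.
  by apply: sumr_ge0 => B _; apply: sqr_ge0.
have -> : \sum_(B : {set 'I_n} | #|B| == k.+2) (L * f B - up_op g B) ^+ 2 =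
    L ^+ 2 * N - 2 * L * G
    + \sum_(B : {set 'I_n} | #|B| == k.+2) up_op g B ^+ 2.
  rewrite -fg !mulr_sumr -sumrB -big_split /=.
  by apply: eq_bigr => B _; ring.
move=> H; have : 0 <= L * (L * N - G) by nra.
by rewrite pmulr_rge0 // subr_ge0.
Qed.

(* n is the spectral gap of the Johnson graph. *)
Lemma johnson_poincare k f : (k.+1 < n)%N ->
  \sum_(B : {set 'I_n} | #|B| == k.+1) f B = 0 ->
  2 * n%:R * \sum_(B : {set 'I_n} | #|B| == k.+1) f B ^+ 2 <=
  \sum_(S : {set 'I_n} | #|S| == k) \sum_(a | a \notin S) \sum_(b | b \notin S)
     (f (a |: S) - f (b |: S)) ^+ 2.
Proof.
move=> kn sum_f; set N := \sum_(B : {set 'I_n} | #|B| == k.+1) f B ^+ 2.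
have H := down_norm_le k f kn sum_f; rewrite -/N in H.
have E : \sum_(S : {set 'I_n} | #|S| == k) \sum_(a | a \notin S)
      f (a |: S) ^+ 2 = k.+1%:R * N.
  rewrite -(sum_flags k (fun B _ => f B ^+ 2)) /N mulr_sumr.
  by apply: eq_bigr => B /eqP cB; rewrite sumr_const cB mulr_natl.
(* Over a fixed [S] the ordered pairs give twice (n-k) times the sum of squares minus the square of
   the sum; that last square is what [down_norm_le] controls. *)
have -> : \sum_(S : {set 'I_n} | #|S| == k) \sum_(a | a \notin S)
     \sum_(b | b \notin S) (f (a |: S) - f (b |: S)) ^+ 2 =
   2 * ((n - k)%:R * (k.+1%:R * N)
     - \sum_(S : {set 'I_n} | #|S| == k) down_op f S ^+ 2).
  rewrite -E !mulr_sumr -sumrB mulr_sumr; apply: eq_bigr => S /eqP cS.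
  set Q := \sum_(a | a \notin S) f (a |: S) ^+ 2.
  transitivity (\sum_(a | a \notin S)
     ((n - k)%:R * f (a |: S) ^+ 2 + Q - 2 * f (a |: S) * down_op f S)).
    apply: eq_bigr => a _.
    rewrite -cS -sum_notin_const /Q /down_op mulr_sumr.
    by rewrite -big_split -sumrB /=; apply: eq_bigr => b _; ring.
  rewrite sumrB big_split /= -mulr_sumr -/Q sum_notin_const cS.
  by rewrite -mulr_suml -mulr_sumr -/(down_op f S); ring.
rewrite -mulrA ler_pM2l // lerBrDr.
(* The gap appears as (n-k)(k+1) - k(n-k-1) = n. *)
apply: le_trans (_ : n%:R * N + (k * (n - k.+1))%:R * N <= _).
  by rewrite lerD2l.
rewrite le_eqVlt; apply/orP; left; apply/eqP.
have kn1 := ltnW kn; rewrite !natrM (natrB _ kn1) (natrB _ (ltnW kn1)).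
by rewrite -!natr1; ring.
Qed.

End JohnsonPoincare.

Lemma card_layer n k : #|layer n k| = 'C(n, k).
Proof. by rewrite card_draws card_ord. Qed.

(** * Truncated distance as a test function for two far-apart families *)

Section Separator.
Import Order.TTheory GRing.Theory Num.Theory.
Import mathcomp.algebra_tactics.ring mathcomp.algebra_tactics.lra.
Variables (n k r : nat) (P1 P0 : {set {set 'I_n}}).
Hypotheses (kn : k.+1 < n) (r_gt0 : 0 < r).
Hypotheses (sP1 : P1 \subset layer n k.+1) (sP0 : P0 \subset layer n k.+1).
Hypothesis far : forall x y, x \in P1 -> y \in P0 -> r < #|y :\: x|.
Implicit Types (S x y : {set 'I_n}).

Let M := layer n k.+1 :\: (P1 :|: P0).

(* r minus the Johnson distance to P1 truncated at r: truncated subtraction in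
   nat performs the truncation. *)
Definition closeness x := \max_(y in P1) (r - #|x :\: y|).

Lemma closeness_P1 x : x \in P1 -> closeness x = r.
Proof.
move=> xP; apply/eqP; rewrite eqn_leq; apply/andP; split.
  by apply/bigmax_leqP => y _; apply: leq_subr.
by apply: leq_trans (leq_bigmax_cond _ xP); rewrite setDv cards0 subn0.
Qed.

Lemma closeness_P0 x : x \in P0 -> closeness x = 0.
Proof.
move=> xP; apply/eqP; rewrite -leqn0; apply/bigmax_leqP => y yP.
by rewrite leqn0 subn_eq0 ltnW ?far.
Qed.

(** Replacing [a] by [b] adds at most the element [b] to the difference with any fixed [y], and
    truncation and maximum preserve this. *)
Lemma closeness_lip S a b : closeness (a |: S) <= (closeness (b |: S)).+1.
Proof.
apply/bigmax_leqP => y yP.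
apply: leq_trans (_ : (r - #|(b |: S) :\: y|).+1 <= _); last first.
  by rewrite ltnS (leq_bigmax_cond _ yP).
rewrite leq_subLR addnS -addSn -leq_subLR leq_sub2l //.
apply: leq_trans (_ : #|b |: ((a |: S) :\: y)| <= _).
  apply: subset_leq_card; apply/subsetP => z; rewrite !inE.
  by case: (z == b) => //=; case: (z \in y) => //= ->; rewrite orbT.
by rewrite cardsU1 -add1n leq_add2r leq_b1.
Qed.

Lemma setU1_layer S a : #|S| = k -> a \notin S -> a |: S \in layer n k.+1.
Proof. by move=> cS aS; rewrite inE cardsU1 aS cS. Qed.

(** Neighbours differ in at most one element and r >= 1, so by [far] they cannot lie in opposite
    families; on each family [closeness] is constant. *)
Lemma closeness_diff S a b : #|S| = k -> a \notin S -> b \notin S ->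
  a |: S \notin M -> b |: S \notin M -> closeness (a |: S) = closeness (b |: S).
Proof.
move=> cS aS bS; rewrite 2!in_setD !setU1_layer // !andbT !negbK !in_setU.
have near u v : #|(u |: S) :\: (v |: S)| <= r.
  apply: leq_trans r_gt0; rewrite -(cards1 u); apply: subset_leq_card.
  apply/subsetP => z; rewrite !inE.
  by case: (z == u) => //=; case: (z \in S); rewrite ?orbT ?andbF.
have nP u v : u |: S \in P1 -> v |: S \in P0 -> False.
  by move=> uP vP; have := far _ _ uP vP; rewrite ltnNge near.
case/orP=> aP /orP[] bP; rewrite ?(closeness_P1 _ aP) ?(closeness_P0 _ aP).
- by rewrite closeness_P1.
- by case: (nP a b).
- by case: (nP b a).
- by rewrite closeness_P0.
Qed.

Local Open Scope ring_scope.

Lemma sum_layer_setU1_M :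
  \sum_(S : {set 'I_n} | #|S| == k) \sum_(a | a \notin S) (a |: S \in M)%:R =
  (k.+1 * #|M|)%:R :> rat.
Proof.
rewrite -(sum_flags rat n k (fun B _ => (B \in M)%:R)).
transitivity (\sum_(B : {set 'I_n} | #|B| == k.+1) (if B \in M then k.+1%:R else 0) : rat).
  apply: eq_bigr => B /eqP cB; rewrite sumr_const cB.
  by case: ifP => //= _; rewrite mul0rn.
rewrite -big_mkcondr /= natrM mulr_natr -sumr_const.
apply: eq_bigl => B; rewrite andb_idl // => /setDP[].
by rewrite inE.
Qed.

Let g x : rat := (closeness x)%:R.

(** An edge contributes at most 1, and only when an end lies in [M], so it can be charged to its
    ends in [M]. *)
Lemma closeness_energy :
  \sum_(S : {set 'I_n} | #|S| == k) \sum_(a | a \notin S) \sum_(b | b \notin S)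
     (g (a |: S) - g (b |: S)) ^+ 2 <= 2 * ((n - k.+1) * k.+1 * #|M|)%:R.
Proof.
have step S a b : #|S| = k -> a \notin S -> b \notin S ->
   (g (a |: S) - g (b |: S)) ^+ 2 <= (a |: S \in M)%:R + (b |: S \in M)%:R.
  move=> cS aS bS.
  have [/orP inM|] := boolP ((a |: S \in M) || (b |: S \in M)); last first.
    by move=> /norP[aM bM]; rewrite /g (closeness_diff S a b) // subrr expr0n addr_ge0.
  apply: (@le_trans _ _ 1).
    have : g (a |: S) <= g (b |: S) + 1 by rewrite /g natr1 ler_nat closeness_lip.
    have : g (b |: S) <= g (a |: S) + 1 by rewrite /g natr1 ler_nat closeness_lip.
    by nra.
  by case: inM => ->; rewrite ?lerDl ?lerDr.
rewrite -mulnA natrM -sum_layer_setU1_M !mulr_sumr; apply: ler_sum => S /eqP cS.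
set h : 'I_n -> rat := fun a => (a |: S \in M)%:R.
set H : rat := \sum_(a | a \notin S) h a; rewrite -/H.
have cT : (n - k.+1)%:R = (n - k)%:R - 1 :> rat.
  by rewrite (natrB _ (ltnW kn)) (natrB _ (ltnW (ltnW kn))) -natr1; ring.
(* The term b = a vanishes; removing its charge [2 * h a] turns [n - k] into [n - k.+1]. *)
apply: (@le_trans _ _ (\sum_(a | a \notin S) ((n - k)%:R * h a + H - 2 * h a))).
  apply: ler_sum => a aS.
  apply: (@le_trans _ _ (\sum_(b | b \notin S) (h a + h b) - 2 * h a)); last first.
    by rewrite big_split /= sum_notin_const cS.
  rewrite (bigD1 a) //= subrr expr0n add0r [X in _ <= X - _](bigD1 a) //=.
  rewrite mulr_natl mulr2n addrAC subrr add0r.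
  by apply: ler_sum => b /andP[bS _]; apply: step.
rewrite sumrB big_split /= -!mulr_sumr sum_notin_const cS -/H cT.
by rewrite le_eqVlt; apply/orP; left; apply/eqP; ring.
Qed.

(** The variance of [closeness] is squeezed between its energy, through the Poincare inequality, and
    the spread forced by its values r on [P1] and 0 on [P0]. *)
Lemma separator_bound :
  (n * (#|P1| * #|P0| * r ^ 2) <=
   (n - k.+1) * k.+1 * #|M| * #|layer n k.+1|)%N.
Proof.
have P10 : [disjoint P1 & P0].
  apply/pred0P => x /=; apply/negP => /andP[x1 x0].
  by have := far _ _ x1 x0; rewrite setDv cards0.
set N : rat := #|layer n k.+1|%:R.
pose m : rat := (\sum_(B in layer n k.+1) g B) / N.
have in_layer (f : {set 'I_n} -> rat) : \sum_(B : {set 'I_n} | #|B| == k.+1) f B =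
    \sum_(B in layer n k.+1) f B.
  by apply: eq_bigl => B; rewrite inE.
have N_gt0 : 0 < N.
  by rewrite ltr0n card_layer bin_gt0 ltnW.
pose f B := g B - m.
have sum_f : \sum_(B : {set 'I_n} | #|B| == k.+1) f B = 0.
  rewrite in_layer sumrB sumr_const -mulr_natl -/N /m mulrCA divff ?mulr1 ?subrr //.
  by rewrite gt_eqF.
have := johnson_poincare _ _ _ f kn sum_f.
rewrite in_layer; set V := \sum_(B in _) _ => poincare.
have {}poincare : n%:R * V <= ((n - k.+1) * k.+1 * #|M|)%:R.
  rewrite -(@ler_pM2l _ 2) // mulrA; apply: le_trans poincare _.
  apply: le_trans closeness_energy; rewrite le_eqVlt; apply/orP; left; apply/eqP.
  apply: eq_bigr => S _; apply: eq_bigr => a _; apply: eq_bigr => b _.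
  by rewrite /f opprB addrA subrK.
set p1 : rat := #|P1|%:R; set p0 : rat := #|P0|%:R.
(* The contribution of [M] to the variance is nonnegative and is dropped. *)
have V_ge : p1 * (r%:R - m) ^+ 2 + p0 * m ^+ 2 <= V.
  rewrite /V (big_setID P1) /= (setIidPr sP1); apply: lerD.
    rewrite /p1 mulr_natl -sumr_const le_eqVlt; apply/orP; left; apply/eqP.
    by apply: eq_bigr => x xP; rewrite /f /g closeness_P1.
  rewrite (big_setID P0) /= (setIidPr _); last first.
    by rewrite subsetD sP0 disjoint_sym.
  rewrite -[leLHS]addr0; apply: lerD; last by apply: sumr_ge0 => B _; apply: sqr_ge0.
  rewrite /p0 mulr_natl -sumr_const le_eqVlt; apply/orP; left; apply/eqP.
  by apply: eq_bigr => x xP; rewrite /f /g closeness_P0 // add0r sqrrN.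
have p_le : p1 + p0 <= N.
  rewrite -natrD ler_nat -cardsUI (disjoint_setI0 P10) cards0 addn0.
  by apply: subset_leq_card; rewrite subUset sP1 sP0.
have p1_ge0 : 0 <= p1 by apply: ler0n.
have p0_ge0 : 0 <= p0 by apply: ler0n.
have NV : p1 * p0 * r%:R ^+ 2 <= V * N.
  set W := p1 * (r%:R - m) ^+ 2 + p0 * m ^+ 2 in V_ge.
  have W_ge0 : 0 <= W by apply: addr_ge0; apply: mulr_ge0 => //; apply: sqr_ge0.
  apply: (@le_trans _ _ (W * (p1 + p0))).
    rewrite -subr_ge0.
    (* This perfect square removes the unknown mean [m]. *)
    have -> : W * (p1 + p0) - p1 * p0 * r%:R ^+ 2 = (p1 * (r%:R - m) - p0 * m) ^+ 2.
      by rewrite /W; ring.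
    exact: sqr_ge0.
  by apply: ler_pM => //; apply: addr_ge0.
rewrite -(ler_nat rat) natrM [leRHS]natrM -/N natrM natrX natrM.
apply: le_trans (_ : n%:R * V * N <= _); first by rewrite -[leRHS]mulrA ler_wpM2l.
by rewrite ler_wpM2r // ltW.
Qed.

End Separator.

(** * Shadow densities, and the pure sets as a far-apart pair *)

Section Shadows.
Import mathcomp.algebra_tactics.ring.
Variable n : nat.
Implicit Types (A : {set {set 'I_n}}) (S B : {set 'I_n}).

(** Complementation turns these supersets into subsets of [~: S] of size n-k-r. *)
Lemma card_supersets k r S : #|S| = k -> k + r <= n ->
  #|[set B : {set 'I_n} | (S \subset B) && (#|B| == k + r)]| = 'C(n - k, r).
Proof.
move=> cS krn; have cC : #|~: S| = n - k by rewrite cardsCs setCK card_ord cS.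
have rn : r <= n - k by rewrite leq_subRL // (leq_trans (leq_addr _ _) krn).
rewrite -(bin_sub rn) -cC -cards_draws -[RHS](card_imset _ (inv_inj (@setCK _))).
apply: eq_card => B; rewrite inE; apply/idP/imsetP => [/andP[SB /eqP cB]|[D]].
  exists (~: B); last by rewrite setCK.
  by rewrite inE setCS SB cC [#|~: B|]cardsCs setCK card_ord cB subnDA eqxx.
rewrite inE => /andP[DS /eqP cD] ->; rewrite -setCS setCK DS /=.
by rewrite cardsCs setCK cD cC card_ord; lia.
Qed.

(** Both sides equal the trinomial coefficient n! / (k! r! (n-k-r)!). *)
Lemma bin_mul_bin k r : k + r <= n ->
  'C(n, k) * 'C(n - k, r) = 'C(n, k + r) * 'C(k + r, k).
Proof.
move=> krn.
have kn : k <= n by apply: leq_trans krn; apply: leq_addr.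
have rn : r <= n - k by rewrite leq_subRL.
apply/eqP; rewrite -(@eqn_pmul2r (k`! * (r`! * (n - (k + r))`!))); last first.
  by rewrite !muln_gt0 !fact_gt0.
have E1 := bin_fact kn; have E2 := bin_fact rn; have E3 := bin_fact krn.
have := bin_fact (leq_addr r k); rewrite addKn => E4.
apply/eqP; transitivity (n`!).
  by rewrite -E1 -E2 subnDA; ring.
by rewrite -E3 -E4; ring.
Qed.

(** Local LYM, cross-multiplied to stay in [nat]: count pairs of [S] in [A] inside [B] in the
    shadow. Each [S] has exactly C(n-k, r) such [B], each [B] at most C(k+r, k) such [S]. *)
Lemma upper_shadow_density k r A : A \subset layer n k -> k + r <= n ->
  #|A| * 'C(n, k + r) <= #|upper_shadow k r A| * 'C(n, k).
Proof.
move=> sA krn.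
have flags : #|A| * 'C(n - k, r) <= #|upper_shadow k r A| * 'C(k + r, k).
  rewrite -!sum_nat_const.
  apply: (@leq_trans (\sum_(S in A) \sum_(B in upper_shadow k r A) (S \subset B))).
    apply: leq_sum => S SA.
    have /eqP cS : #|S| == k by move/subsetP/(_ S SA): sA; rewrite inE.
    rewrite -(card_supersets k r S cS krn) -sum1_card big_mkcond [leqRHS]big_mkcond /=.
    apply: leq_sum => B _; rewrite !inE.
    case: ifP => // /andP[SB ->] /=.
    by case: existsP => [|[]]; [rewrite SB | exists S; rewrite SA].
  rewrite exchange_big; apply: leq_sum => B; rewrite inE => /andP[/eqP cB _].
  rewrite -cB -cards_draws -sum1_card big_mkcond [leqRHS]big_mkcond /=.
  apply: leq_sum => S _; case: ifP => // SA.
  have cS : #|S| == k by move/subsetP/(_ S SA): sA; rewrite inE.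
  by rewrite inE cS andbT; case: (S \subset B).
rewrite -(@leq_pmul2r 'C(k + r, k)) ?bin_gt0 ?leq_addr //.
rewrite -mulnA -bin_mul_bin // [leqRHS]mulnAC.
by rewrite mulnCA [leqRHS]mulnC leq_mul2l flags orbT.
Qed.

Lemma exists_subset_card k B : k <= #|B| -> exists2 S : {set 'I_n}, S \subset B & #|S| = k.
Proof.
rewrite -bin_gt0 -cards_draws card_gt0 => /set0Pn[S].
by rewrite inE => /andP[SB /eqP cS]; exists S.
Qed.

Lemma upper_shadow_sub_layer k r A : upper_shadow k r A \subset layer n (k + r).
Proof. by apply/subsetP => B; rewrite !inE => /andP[]. Qed.

Lemma mem_upper_shadow k r A S B :
  S \in A -> S \subset B -> #|B| = k + r -> B \in upper_shadow k r A.
Proof.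
move=> SA SB cB; rewrite inE cB eqxx /=.
by apply/existsP; exists S; rewrite SA.
Qed.

Lemma upper_shadowU_compl r A :
  upper_shadow n./2 r A :|: upper_shadow n./2 r (compl_mid A) = layer n (n./2 + r).
Proof.
apply/eqP; rewrite eqEsubset subUset !upper_shadow_sub_layer /=.
apply/subsetP => B; rewrite inE => /eqP cB.
have [S SB cS] : exists2 S : {set 'I_n}, S \subset B & #|S| = n./2.
  by apply: exists_subset_card; rewrite cB leq_addr.
rewrite in_setU; have [SA|SA] := boolP (S \in A).
  by rewrite (mem_upper_shadow _ _ _ _ _ SA SB cB).
rewrite (mem_upper_shadow _ _ (compl_mid A) _ _ _ SB cB) ?orbT //.
by rewrite /compl_mid in_setD SA inE cS eqxx.
Qed.

Section MixedSets.
Variables (r : nat) (A : {set {set 'I_n}}).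
Let U := upper_shadow n./2 r A.
Let V := upper_shadow n./2 r (compl_mid A).
Let K := n./2 + r.

(** [separator_bound] with P1 the sets missed by [V] (all middle subsets in [A]) and P0 those missed
    by [U] (none in [A]). *)
Lemma mixed_shadow_bound : 0 < r -> K < n ->
  n * (#|layer n K :\: V| * #|layer n K :\: U| * r ^ 2) <=
  (n - K) * K * #|U :&: V| * #|layer n K|.
Proof.
move=> r_gt0 Kn.
have [k kE] : exists k, K = k.+1 by exists K.-1; rewrite prednK // addn_gt0 r_gt0 orbT.
have far x y : x \in layer n K :\: V -> y \in layer n K :\: U -> r < #|y :\: x|.
  move=> /setDP[xK xV] /setDP[yK yU]; rewrite ltnNge; apply/negP => near.
  rewrite !inE in xK yK; move/eqP: xK => xK; move/eqP: yK => yK.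
  (* If at most r elements of [y] lie outside [x], the intersection has at least K - r = n/2
     elements. A common middle subset would put [y] in [U] or [x] in [V]. *)
  have [S] : exists2 S : {set 'I_n}, S \subset y :&: x & #|S| = n./2.
    apply: exists_subset_card.
    by have := cardsID x y; rewrite yK /K; lia.
  rewrite subsetI => /andP[Sy Sx] cS.
  have [SA|SA] := boolP (S \in A).
    by rewrite (mem_upper_shadow _ _ _ _ _ SA Sy yK) in yU.
  rewrite (mem_upper_shadow _ _ (compl_mid A) _ _ _ Sx xK) // in xV.
  by rewrite /compl_mid in_setD SA inE cS eqxx.
have -> : U :&: V = layer n K :\: (layer n K :\: V :|: layer n K :\: U).
  rewrite setDUr !setDDr !setDv !set0U setIC.
  apply/setP => B; rewrite !inE.
  by case: (_ == _) => //=; case: [exists _ in _, _]; case: [exists _ in _, _].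
rewrite kE in Kn far *.
by apply: separator_bound => //; apply: subsetDl.
Qed.

End MixedSets.

End Shadows.

(** * Real inequalities: ceiling, logarithm, and passage from counts to measures *)

Section RealEstimates.
Local Open Scope R_scope.

Lemma nat_ceil_bounds x : 0 < x -> x <= INR (nat_ceil x) < x + 1.
Proof.
move=> x_gt0; have [up_gt up_le] := archimed (- x).
have zE : IZR (Defs.Zceil x) = 1 - IZR (up (- x)) by rewrite /Defs.Zceil minus_IZR.
(* [Z.to_nat] sends negative integers to 0, so the sign has to be settled first. *)
have z_ge0 : Z.le 0 (Defs.Zceil x) by apply: le_IZR; lra.
by rewrite /nat_ceil INR_IZR_INZ Z2Nat.id //; lra.
Qed.

Lemma ln_le x y : 0 < x -> x <= y -> ln x <= ln y.
Proof. by move=> x_gt0 [xy|->]; [left; exact: ln_increasing | lra]. Qed.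

Lemma variance_bounds a : 0 < a < 1 -> 0 < a * (1 - a) <= 1 / 4.
Proof. by move=> a01; have := Rle_0_sqr (a - 1 / 2); rewrite /Rsqr; nra. Qed.

Lemma one_le_ln_4 x : 4 <= x -> 1 <= ln x.
Proof.
move=> x4; have e3 := exp_le_3.
rewrite -(ln_exp 1); apply: ln_le; [exact: exp_pos | lra].
Qed.

Lemma four_le_inv x : 0 < x <= 1 / 4 -> 4 <= 1 / x.
Proof.
move=> x_bd; apply: (Rmult_le_reg_r x); first lra.
have -> : 1 / x * x = 1 by field; lra.
    lra.
Qed.

(** Here a is the measure of the family, d that of the mixed sets, and p1, p0 those of the pure
    sets. *)
Lemma gap_of_variance (a d p1 p0 eps n r : R) :
  0 < a < 1 -> 0 < eps < 1 -> 0 < n -> 0 <= d ->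
  a - d <= p1 -> 1 - a - d <= p0 -> eps ^ 2 * n <= r ^ 2 ->
  n * (p1 * p0 * r ^ 2) <= n ^ 2 / 4 * d ->
  eps ^ 2 / 2 * (a * (1 - a)) <= d.
Proof.
move=> a01 eps01 n_gt0 d_ge0 p1_ge p0_ge r_ge var_le.
have eps2 : 0 < eps ^ 2 < 1 by nra.
set v := a * (1 - a).
have v_gt0 : 0 < v by rewrite /v; nra.
(* If d >= v/2, then eps < 1 suffices. Otherwise d is below both a/2 and (1-a)/2, so each pure part
   keeps half its mass and the variance bound gives d >= eps^2 v. *)
case: (Rle_lt_dec (v / 2) d) => [|d_lt]; first by nra.
have p1_half : a / 2 <= p1 by rewrite /v in d_lt; nra.
have p0_half : (1 - a) / 2 <= p0 by rewrite /v in d_lt; nra.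
have p_ge : v / 4 <= p1 * p0.
  have := Rmult_le_compat (a / 2) p1 ((1 - a) / 2) p0.
  by rewrite /v; lra.
have prod_ge : v / 4 * (eps ^ 2 * n) <= p1 * p0 * r ^ 2.
  by apply: Rmult_le_compat => //; nra.
have var_ge : n * (v / 4 * (eps ^ 2 * n)) <= n ^ 2 / 4 * d.
  by apply: Rle_trans var_le; apply: Rmult_le_compat_l => //; lra.
have : n ^ 2 / 4 * (eps ^ 2 * v) <= n ^ 2 / 4 * d by lra.
move/Rmult_le_reg_l => H; have := H ltac:(nra); nra.
Qed.

(** Normalises cardinalities for [gap_of_variance]: a, ac for the family and its complement, u, v
    for their shadows, d for the shadows' intersection, q1, q0 for the pure sets, N1, N for the two
    layers, X for (n-K)K. *)
Lemma gap_of_counts (a ac u v d q1 q0 N N1 X eps n r : R) :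
  0 < N -> 0 < N1 -> 0 < n -> 0 < eps < 1 -> 0 <= d ->
  0 < a / N1 < 1 -> a + ac = N1 -> u + v = d + N -> q1 + v = N -> q0 + u = N ->
  a * N <= u * N1 -> ac * N <= v * N1 -> eps ^ 2 * n <= r ^ 2 ->
  n * (q1 * q0 * r ^ 2) <= X * d * N -> 4 * X <= n ^ 2 ->
  eps ^ 2 / 2 * (a / N1 * (1 - a / N1)) <= d / N.
Proof.
move=> N_gt0 N1_gt0 n_gt0 eps01 d_ge0 a01 aE uvE q1E q0E u_ge v_ge r_ge var_le X_le.
have div_le x y : x * N <= y * N1 -> x / N1 <= y / N.
  move=> xy; apply: (Rmult_le_reg_r (N * N1)); first nra.
  have -> : x / N1 * (N * N1) = x * N by field; lra.
  have -> : y / N * (N * N1) = y * N1 by field; lra.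
  lra.
have {}u_ge := div_le _ _ u_ge; have {}v_ge := div_le _ _ v_ge.
have acE : 1 - a / N1 = ac / N1 by rewrite -aE; field; lra.
apply: (gap_of_variance _ _ (q1 / N) (q0 / N) _ n r) => //.
- by apply: Rle_mult_inv_pos.
- have -> : q1 / N = u / N - d / N by rewrite (_ : q1 = u - d); [field; lra | lra].
  lra.
- rewrite acE; have -> : q0 / N = v / N - d / N.
    by rewrite (_ : q0 = v - d); [field; lra | lra].
  lra.
apply: (Rmult_le_reg_r (N ^ 2)); first nra.
have -> : n * (q1 / N * (q0 / N) * r ^ 2) * N ^ 2 = n * (q1 * q0 * r ^ 2).
  by field; lra.
have -> : n ^ 2 / 4 * (d / N) * N ^ 2 = n ^ 2 / 4 * (d * N) by field; lra.
apply: Rle_trans var_le _; rewrite Rmult_assoc.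
by apply: Rmult_le_compat_r; [nra | lra].
Qed.

End RealEstimates.

(** * Assembly and choice of constants *)

Local Open Scope R_scope.

Theorem theorem1 :
  exists C c : R, 0 < C /\ 0 < c /\
  forall (eps : R) (n : nat) (A : {set {set 'I_n}}),
    0 < eps < 1 -> (0 < n)%N -> ~~ odd n ->
    A \subset layer n n./2 -> A != set0 -> A != layer n n./2 ->
    let m := mu n./2 A in
    INR n >= C / eps ^ 2 * (ln (1 / eps) + ln (1 / (m * (1 - m)))) ->
    let r := nat_ceil (eps * sqrt (INR n)) in
    mu (n./2 + r)
        (upper_shadow n./2 r A :&: upper_shadow n./2 r (compl_mid A))
     >= c * eps ^ 2 / ln (1 / (eps * m * (1 - m))) * (m * (1 - m)).
Proof.
(* 16 forces n >= 16; 1/2 is the factor lost in [gap_of_variance]. *)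
exists 16, (1 / 2); split; first lra; split; first lra.
move=> eps n A eps01 n_gt0 n_even sA A0 AT m n_ge r.
have INR_bin_gt0 k : (k <= n)%N -> 0 < INR 'C(n, k).
  by move=> kn; apply/lt_0_INR/ltP; rewrite bin_gt0.
have half_le : (n./2 <= n)%N by rewrite -divn2 leq_div.
have Nk := INR_bin_gt0 _ half_le.
have m01 : 0 < m < 1.
  split; first by apply: Rdiv_lt_0_compat => //; apply/lt_0_INR/ltP; rewrite card_gt0.
  apply: (Rmult_lt_reg_r (INR 'C(n, n./2))) => //.
  rewrite /m /mu Rmult_1_l /Rdiv Rmult_assoc Rinv_l ?Rmult_1_r; last lra.
  apply/lt_INR/ltP; rewrite -card_layer; apply: proper_card.
  by rewrite properEneq AT.
have v_bd := variance_bounds _ m01.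
(* Since m(1-m) <= 1/4, its logarithmic term is at least ln 4 >= 1, while 16 / eps^2 >= 16. *)
have n16 : 16 <= INR n.
  have ln_eps : 0 <= ln (1 / eps).
    rewrite -ln_1; apply: ln_le; first lra.
    apply: (Rmult_le_reg_r eps); first lra.
    have -> : 1 / eps * eps = 1 by field; lra.
    lra.
  have ln_v := one_le_ln_4 _ (four_le_inv _ v_bd).
  have : 16 <= 16 / eps ^ 2.
    have e2 : 0 < eps ^ 2 < 1 by nra.
    apply: (Rmult_le_reg_r (eps ^ 2)); first lra.
    have -> : 16 / eps ^ 2 * eps ^ 2 = 16 by field; lra.
    lra.
  by nra.
have s_ge : 4 <= sqrt (INR n).
  by rewrite -(sqrt_square 4); [apply: sqrt_le_1_alt; lra | lra].
have s_sq : sqrt (INR n) * sqrt (INR n) = INR n by apply: sqrt_sqrt; lra.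
have [r_ge r_lt] : eps * sqrt (INR n) <= INR r < eps * sqrt (INR n) + 1.
  by apply: nat_ceil_bounds; nra.
have r_gt0 : (0 < r)%N by apply/ltP/INR_lt => /=; nra.
have halfE : INR n = INR n./2 + INR n./2.
  by rewrite -plus_INR plusE addnn even_halfK.
(* With s the root of n and s >= 4, r < s + 1 < s^2 / 2; this keeps the layer n/2 + r strictly below
   n. *)
have r_lt_half : (r < n./2)%N by apply/ltP/INR_lt; nra.
have Kn : (n./2 + r < n)%N.
  by rewrite -[X in (_ < X)%N]even_halfK // -addnn ltn_add2l.
set U := upper_shadow n./2 r A; set V := upper_shadow n./2 r (compl_mid A).
set K := (n./2 + r)%N in Kn *.
have NK := INR_bin_gt0 _ (ltnW Kn).
set N := INR 'C(n, K) in NK; set N1 := INR 'C(n, n./2) in Nk.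
have sAc : compl_mid A \subset layer n n./2 by apply: subsetDl.
have u_ge := upper_shadow_density _ _ r _ sA (ltnW Kn).
have v_ge := upper_shadow_density _ _ r _ sAc (ltnW Kn).
have := mixed_shadow_bound _ _ A r_gt0 Kn.
rewrite -/U -/V -/K card_layer in u_ge v_ge *.
have cardUV : (#|U| + #|V| = #|U :&: V| + 'C(n, K))%N.
  by rewrite -cardsUI addnC upper_shadowU_compl card_layer.
have cardP (B : {set {set 'I_n}}) : B \subset layer n K -> (#|layer n K :\: B| + #|B| = 'C(n, K))%N.
  by move=> sB; rewrite -card_layer -(cardsID B (layer n K)) (setIidPr sB) addnC.
have cardP1 := cardP V (upper_shadow_sub_layer _ _ _ _).
have cardP0 := cardP U (upper_shadow_sub_layer _ _ _ _).
have cardA : (#|A| + #|compl_mid A| = 'C(n, n./2))%N.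
  by rewrite -card_layer -[RHS](cardsID A) (setIidPr sA).
(* AM-GM for n-K and K, whose sum is n. *)
have K4 : (4 * ((n - K) * K) <= n ^ 2)%N.
  by have [] := nat_AGM2 (n - K) K; rewrite (subnK (ltnW Kn)).
move=> mixed.
have toR (x y : nat) : (x <= y)%N -> INR x <= INR y by move/leP/le_INR.
move: (congr1 INR cardUV) (congr1 INR cardP1) (congr1 INR cardP0) (congr1 INR cardA).
move: (toR _ _ u_ge) (toR _ _ v_ge) (toR _ _ mixed) (toR _ _ K4).
rewrite -!mulnn -!plusE -!multE !plus_INR !mult_INR -/N -/N1.
move=> uR vR mixedR XR uvE q1E q0E aE.
have gap : eps ^ 2 / 2 * (m * (1 - m)) <= mu K (U :&: V).
  apply: (gap_of_counts _ (INR #|compl_mid A|) (INR #|U|) (INR #|V|) _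
    (INR #|layer n K :\: V|) (INR #|layer n K :\: U|) _ _
    (INR (n - K)%N * INR K) _ (INR n) (INR r)) => //; try lra.
  - exact: pos_INR.
  - have s_eps : 0 <= eps * sqrt (INR n) by apply: Rmult_le_pos; lra.
    have -> : eps ^ 2 * INR n = (eps * sqrt (INR n)) ^ 2 by rewrite -[in LHS]s_sq; ring.
    by apply: pow_incr.
  - by rewrite (_ : INR r ^ 2 = INR r * INR r) //; ring.
  - have INR0 : INR 0 = 0 by [].
    by rewrite (_ : INR n ^ 2 = INR n * INR n); [lra | ring].
(* The argument of the logarithm is at least 4, so dividing by [L] only weakens [gap]. *)
have v_eps : 0 < eps * m * (1 - m) <= 1 / 4 by rewrite Rmult_assoc; nra.
have L_ge1 := one_le_ln_4 _ (four_le_inv _ v_eps).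
set L := ln _ in L_ge1 *.
have L_inv : / L <= 1 by rewrite -Rinv_1; apply: Rinv_le_contravar; lra.
have P_ge0 : 0 <= eps ^ 2 / 2 * (m * (1 - m)).
  by apply: Rmult_le_pos; nra.
apply/Rle_ge/(Rle_trans _ _ _ _ gap).
have -> : 1 / 2 * eps ^ 2 / L * (m * (1 - m)) = eps ^ 2 / 2 * (m * (1 - m)) * / L.
  by field; lra.
by rewrite -[X in _ <= X]Rmult_1_r; apply: Rmult_le_compat_l.
Qed.
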